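(* Let $\{f_m,\mathcal F_m\}_{m=0}^\infty$ be a super-martingale relative to a convex set $M$ of equivalent measures such that $\sup_{P\in M}E^P|f_m|<\infty$ for all $m\ge 1$. Then $\{f_m,\mathcal F_m\}_{m=0}^\infty$ is a local regular super-martingale if and only if there exists an adapted nonnegative random process $\{\bar g^0_m,\mathcal F_m\}_{m=0}^\infty$ with $\sup_{P\in M}E^P|\bar g^0_m|<\infty$ for all $m\ge 1$, such that $$f_{m-1}-E^P\{f_m|\mathcal F_{m-1}\}=E^P\{\bar g^0_m|\mathcal F_{m-1}\},\qquad m\ge 1,\quad P\in M.$$
   Context: Let $(\Omega,\mathcal F)$ be a measurable space with a filtration $\mathcal F_0\subset\mathcal F_1\subset\dots\subset\mathcal F$, where $\mathcal F_0=\{\emptyset,\Omega\}$ and $\mathcal F=\sigma(\bigcup_{n\ge1}\mathcal F_n)$, and let $M$ be a convex set of pairwise equivalent probability measures on $\mathcal F$. $E^P$ denotes expectation (or conditional expectation) with respect to $P$. A process $\{\psi_m\}_{m=0}^\infty$ is adapted if each $\psi_m$ is $\mathcal F_m$-measurable. An adapted process $\{f_m\}_{m=0}^\infty$ is a super-martingale relative to $M$ if $E^P|f_m|<\infty$ for all $m\ge1$, $P\in M$, and $E^P\{f_m|\mathcal F_k\}\le f_k$ for all $0\le k\le m$ and all $P\in M$. A super-martingale $\{f_m,\mathcal F_m\}_{m=0}^\infty$ relative to $M$ is local regular if $\sup_{P\in M}E^P|f_m|<\infty$ for all $m\ge1$ and there exists an adapted nonnegative increasing (i.e. non-decreasing in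 $m$) process $\{g_m,\mathcal F_m\}_{m=0}^\infty$ with $g_0=0$ and $\sup_{P\in M}E^P|g_m|<\infty$ for $m\ge1$, such that $\{f_m+g_m,\mathcal F_m\}_{m=0}^\infty$ is a martingale relative to every measure from $M$. *)

(* Defs.v *)
From HB Require Import structures.
From mathcomp Require Export all_boot all_order all_algebra.
From mathcomp Require Export all_classical all_reals all_analysis.

Set Implicit Arguments.
Unset Strict Implicit.
Unset Printing Implicit Defensive.

Export Order.TTheory GRing.Theory Num.Theory.
Export numFieldNormedType.Exports.

#[global] Open Scope classical_set_scope.
#[global] Open Scope ring_scope.

Definition filtration (d : measure_display) (T : measurableType d)
    (F : nat -> set (set T)) : Prop :=
  [/\ forall n, sigma_algebra setT (F n),
      forall m n, (m <= n)%N -> F m `<=` F n,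
      forall n, F n `<=` @measurable d T,
      F 0%N = [set set0; setT]
    & @measurable d T = <<s \bigcup_(n in [set n | (1 <= n)%N]) F n >>].

(* A term of type [probability T R] also carries (meaningless) values on
   non-measurable sets, so a convex combination is only required to be
   represented in [M] up to its values on measurable sets. *)
Definition convex_measures (R : realType) (d : measure_display)
    (T : measurableType d) (M : set (probability T R)) : Prop :=
  forall P Q, M P -> M Q -> forall t : R, 0 <= t <= 1 ->
    exists2 S, M S & forall A, measurable A ->
      S A = (t%:E * P A + (1 - t)%:E * Q A)%E.

Definition equivalent_measures (R : realType) (d : measure_display)
    (T : measurableType d) (M : set (probability T R)) : Prop :=
  forall P Q, M P -> M Q -> P `<< Q /\ Q `<< P.

Definition measurable_wrt (R : realType) (T : Type) (G : set (set T))
    (X : T -> R) : Prop :=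
  forall B : set R, measurable B -> G (X @^-1` B).

Definition adapted (R : realType) (T : Type) (F : nat -> set (set T))
    (f : nat -> T -> R) : Prop :=
  forall m, measurable_wrt (F m) (f m).

Definition is_cond_exp (R : realType) (d : measure_display)
    (T : measurableType d) (P : probability T R) (G : set (set T))
    (X Y : T -> R) : Prop :=
  [/\ measurable_wrt G Y,
      P.-integrable setT (EFin \o Y)
    & forall A, G A ->
        (\int[P]_(w in A) (Y w)%:E = \int[P]_(w in A) (X w)%:E)%E].

(* A chosen version of [E^P{X | G}], with default value 0; for [G] a
   sub-sigma-algebra and [X] integrable a version exists and is unique
   up to [P]-null sets, so (in)equalities below are almost sure. *)
Definition cond_exp (R : realType) (d : measure_display)
    (T : measurableType d) (P : probability T R) (G : set (set T))
    (X : T -> R) : T -> R :=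
  xget (fun=> 0) [set Y | is_cond_exp P G X Y].

Definition supermartingale (R : realType) (d : measure_display)
    (T : measurableType d) (F : nat -> set (set T))
    (M : set (probability T R)) (f : nat -> T -> R) : Prop :=
  [/\ adapted F f,
      forall m P, (1 <= m)%N -> M P ->
        ('E_P[fun w => `|f m w|%R] < +oo)%E
    & forall k m P, (k <= m)%N -> M P ->
        {ae P, forall w, cond_exp P (F k) (f m) w <= f k w}].

Definition martingale (R : realType) (d : measure_display)
    (T : measurableType d) (F : nat -> set (set T))
    (P : probability T R) (f : nat -> T -> R) : Prop :=
  [/\ adapted F f,
      forall m, (1 <= m)%N -> ('E_P[fun w => `|f m w|%R] < +oo)%E
    & forall k m, (k <= m)%N ->
        {ae P, forall w, cond_exp P (F k) (f m) w = f k w}].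

Definition sup_integrable (R : realType) (d : measure_display)
    (T : measurableType d) (M : set (probability T R))
    (f : nat -> T -> R) : Prop :=
  forall m, (1 <= m)%N ->
    (ereal_sup [set 'E_P[fun w => `|f m w|%R] | P in M] < +oo)%E.

Definition local_regular (R : realType) (d : measure_display)
    (T : measurableType d) (F : nat -> set (set T))
    (M : set (probability T R)) (f : nat -> T -> R) : Prop :=
  [/\ supermartingale F M f,
      sup_integrable M f
    & exists g : nat -> T -> R,
        [/\ adapted F g,
            forall m w, 0 <= g m w,
            forall m n w, (m <= n)%N -> g m w <= g n w,
            forall w, g 0%N w = 0
          & sup_integrable M g /\
            forall P, M P -> martingale F P (fun m w => f m w + g m w)]].

(* Main.v *)
Require Import Defs.
From mathcomp Require Import measurable_realfun.

Set Implicit Arguments.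
Unset Strict Implicit.
Unset Printing Implicit Defensive.

(** Both conditions say the same thing about integrals. An adapted integrable
    [Y] is a version of [E^P{X | G}] iff [X] and [Y] have equal integrals over
    every set of [G]. So "[f + g] is a martingale under [P]" and "the increment
    [h_m = g_m - g_(m-1)] compensates [f]" both unfold to
    [\int_A f_(m-1) = \int_A f_m + \int_A h_m] for all [A] in [F_(m-1)], and one
    passes from one process to the other by taking increments or partial
    sums. *)

(** * Measurability with respect to a sub-sigma-algebra *)

Section measurable_wrt.
Context (R : realType) (d : measure_display) (T : measurableType d).
Variable G : set (set T).
Hypothesis sG : sigma_algebra setT G.

(** A sigma-algebra generates itself, so [measurable_wrt G] becomes ordinary measurability on
    [g_sigma_algebraType G] and inherits its closure properties. *)
Lemma measurable_wrtP (X : T -> R) :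
  measurable_wrt G X <->
  measurable_fun [set: g_sigma_algebraType G] (X : g_sigma_algebraType G -> R).
Proof.
split=> [mX _ B mB|mX B mB].
  by rewrite setTI measurable_g_measurableTypeE//; exact: mX.
by have := mX measurableT _ mB; rewrite setTI measurable_g_measurableTypeE.
Qed.

Lemma measurable_wrtD (X Y : T -> R) :
  measurable_wrt G X -> measurable_wrt G Y -> measurable_wrt G (X \+ Y).
Proof.
by move=> /measurable_wrtP mX /measurable_wrtP mY;
  apply/measurable_wrtP; exact: measurable_funD.
Qed.

Lemma measurable_wrtB (X Y : T -> R) :
  measurable_wrt G X -> measurable_wrt G Y -> measurable_wrt G (X \- Y).
Proof.
by move=> /measurable_wrtP mX /measurable_wrtP mY;
  apply/measurable_wrtP; exact: measurable_funB.
Qed.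

Lemma measurable_wrt_cst (c : R) : measurable_wrt G (fun=> c).
Proof. by apply/measurable_wrtP; exact: measurable_cst. Qed.

Hypothesis GT : G `<=` measurable.

Lemma measurable_wrt_measurable_fun (X : T -> R) :
  measurable_wrt G X -> measurable_fun setT X.
Proof. by move=> mX _ B mB; rewrite setTI; exact/GT/mX. Qed.

Lemma measurable_fun_id_sub :
  measurable_fun [set: T] (id : T -> g_sigma_algebraType G).
Proof.
by move=> _ B; rewrite measurable_g_measurableTypeE// setTI => /GT.
Qed.

End measurable_wrt.

(** The preimage of the singleton of [X point] contains [point]; being nonempty, it must be the
    whole space. *)
Lemma measurable_wrt_trivial (R : realType) (d : measure_display)
    (T : measurableType d) (X : T -> R) :
  measurable_wrt [set set0; setT] X -> X = cst (X point).
Proof.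
move=> /(_ _ (measurable_set1 (X point))) [X0|XT].
  have : (X @^-1` [set X point]) point by [].
  by rewrite X0.
apply/funext => w; have : (X @^-1` [set X point]) w by rewrite XT.
by [].
Qed.

(** * Existence, uniqueness and integral characterisation of conditional expectations *)

Section cond_exp.
Context (R : realType) (d : measure_display) (T : measurableType d).
Variables (P : probability T R) (G : set (set T)).
Hypotheses (sG : sigma_algebra setT G) (GT : G `<=` measurable).

Let mid := measurable_fun_id_sub sG GT.

(** The restriction of [P] to [G], obtained as the image of [P] under the identity; integrals then
    transfer by change of variables. *)
Let PG : probability (g_sigma_algebraType G) R :=
  distribution P (mfun_Sub (mem_set mid)).

Let integrable_restr (Y : g_sigma_algebraType G -> \bar R) :
  measurable_fun setT Y ->
  PG.-integrable setT Y <-> P.-integrable setT (Y : T -> \bar R).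
Proof.
move=> mY; have mYT : measurable_fun [set: T] (Y : T -> \bar R).
  exact: (measurableT_comp mY mid).
have E : (\int[PG]_x `|Y x| = \int[P]_(x in [set: T]) `|Y x|)%E.
  rewrite ge0_integral_distribution//.
  exact: measurableT_comp.
by split=> /integrableP[_ iY]; apply/integrableP; split => //;
  rewrite ?E// -E.
Qed.

Let integral_restr (Y : g_sigma_algebraType G -> \bar R) A :
  measurable_fun setT Y -> P.-integrable setT (Y : T -> \bar R) -> G A ->
  (\int[PG]_(x in A) Y x = \int[P]_(x in (A : set T)) Y x)%E.
Proof.
move=> mY iY GA; rewrite /PG /distribution integral_pushforward//.
  apply: integrableS iY => //; exact: GT.
by rewrite measurable_g_measurableTypeE.
Qed.

(** Radon-Nikodym on [G]: the version is the density with respect to [PG] of the charge sending [A]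
    to the integral of [X] over [A]. *)
Lemma is_cond_exp_exists (X : T -> R) : P.-integrable setT (EFin \o X) ->
  exists Y, is_cond_exp P G X Y.
Proof.
move=> iX.
pose nu : {charge set (g_sigma_algebraType G) -> \bar R} :=
  measure_function_pushforward__canonical__charge_Charge
    (charge_induced_charge__canonical__charge_Charge iX) mid.
(* Absolute continuity already holds on [T], where [X] integrates to 0 over every [P]-null set, and
   it passes to images. *)
have nuPG : nu `<< PG.
  apply: dominates_pushforward => //.
  apply/null_content_dominatesP => A mA PA0.
  apply: null_set_integral => //; exact: measurable_funTS (measurable_int _ iX).
have Yfin x := Radon_Nikodym_fin_num x nuPG.
have iY := Radon_Nikodym_integrable nuPG.
(* The density is finite at every point, so [fine] loses nothing. *)
pose Y := fine \o Radon_Nikodym nu PG.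
have YE : EFin \o Y = Radon_Nikodym nu PG by apply/funext => x; rewrite /= fineK.
have mY := measurable_int _ iY.
exists Y; split.
- apply/measurable_wrtP => //; apply/measurable_EFinP.
  by rewrite YE.
- by rewrite YE; exact/(integrable_restr mY).
- move=> A GA; under eq_integral do rewrite -[(Y _)%:E]/((EFin \o Y) _) YE.
  rewrite -(integral_restr mY (iffLR (integrable_restr mY) iY) GA).
  rewrite -Radon_Nikodym_integral//.
  by rewrite measurable_g_measurableTypeE.
Qed.

(** Two versions have equal integrals over every set of [G], hence agree [PG]-almost everywhere; the
    exceptional set lies in [G], so it is also [P]-null. *)
Lemma is_cond_exp_unique (X Y Z : T -> R) :
  is_cond_exp P G X Y -> is_cond_exp P G X Z -> {ae P, forall w, Y w = Z w}.
Proof.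
move=> [/(measurable_wrtP sG)/measurable_EFinP mY iY EY].
move=> [/(measurable_wrtP sG)/measurable_EFinP mZ iZ EZ].
have [A [mA PA AYZ]] : ae_eq PG setT (EFin \o Y) (EFin \o Z).
  apply: integral_ae_eq => //; first exact/integrable_restr.
  move=> A _; rewrite measurable_g_measurableTypeE// => GA.
  by rewrite !integral_restr//= EY// EZ.
exists A; split => //.
  by rewrite measurable_g_measurableTypeE// in mA; exact: GT.
by apply: subset_trans AYZ => w /= YZ; apply: contra_not YZ => /(_ I) [].
Qed.

Lemma cond_expP (X : T -> R) : P.-integrable setT (EFin \o X) ->
  is_cond_exp P G X (cond_exp P G X).
Proof.
by move=> iX; have [Y XY] := is_cond_exp_exists iX; exact: (xgetI _ XY).
Qed.

Lemma Rintegral_cond_exp (X : T -> R) A : P.-integrable setT (EFin \o X) ->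
  G A -> \int[P]_(w in A) cond_exp P G X w = \int[P]_(w in A) X w.
Proof. by move=> /cond_expP[_ _ EX] GA; rewrite /Rintegral EX. Qed.

Lemma cond_exp_aeP (X Y : T -> R) :
  P.-integrable setT (EFin \o X) -> P.-integrable setT (EFin \o Y) ->
  measurable_wrt G Y ->
  {ae P, forall w, cond_exp P G X w = Y w} <->
  forall A, G A -> \int[P]_(w in A) X w = \int[P]_(w in A) Y w.
Proof.
move=> iX iY mY; split=> [XY A GA|XY].
  rewrite -Rintegral_cond_exp// /Rintegral; congr fine.
  have mA := GT GA; have [_ iE _] := cond_expP iX.
  apply: ae_eq_integral => //.
  - exact: measurable_funTS (measurable_int _ iE).
  - exact: measurable_funTS (measurable_int _ iY).
  - by apply: filterS XY => w /= ->.
(* [Y] is itself a version, so uniqueness applies. The hypothesis concerns real-valued integrals;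
   finiteness lifts it to extended reals. *)
apply: is_cond_exp_unique (cond_expP iX) _; split => // A GA.
have mA := GT GA.
have fin Z : P.-integrable setT (EFin \o Z) ->
    (\int[P]_(w in A) (Z w)%:E)%E \is a fin_num.
  by move=> iZ; apply: integrable_fin_num => //; exact: integrableS iZ.
by rewrite -[LHS]fineK ?fin// -[RHS]fineK ?fin//; congr EFin; rewrite -[LHS]XY.
Qed.

End cond_exp.

(** * The compensation identity in integral form *)

Section compensator.
Context (R : realType) (d : measure_display) (T : measurableType d).
Variables (P : probability T R) (G : set (set T)).
Hypotheses (sG : sigma_algebra setT G) (GT : G `<=` measurable).

(** Since [Y] is [G]-measurable, the difference of [Y] and the conditional expectation of [X] is an
    admissible candidate for a version of that of [Z], and [cond_exp_aeP] tests it. *)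
Lemma compensator_aeP (X Y Z : T -> R) :
  P.-integrable setT (EFin \o X) -> P.-integrable setT (EFin \o Y) ->
  P.-integrable setT (EFin \o Z) -> measurable_wrt G Y ->
  {ae P, forall w, Y w - cond_exp P G X w = cond_exp P G Z w} <->
  forall A, G A ->
    \int[P]_(w in A) Y w = \int[P]_(w in A) X w + \int[P]_(w in A) Z w.
Proof.
move=> iX iY iZ mY; have [mE iE _] := cond_expP sG GT iX.
have iYE : P.-integrable setT (EFin \o (Y \- cond_exp P G X)).
  exact: (integrableB measurableT iY iE).
have intYE A : G A -> \int[P]_(w in A) (Y \- cond_exp P G X) w =
    \int[P]_(w in A) Y w - \int[P]_(w in A) X w.
  move=> GA; have mA := GT GA.
  rewrite RintegralB//; [|exact: integrableS iY|exact: integrableS iE].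
  by rewrite Rintegral_cond_exp.
have Zae := cond_exp_aeP sG GT iZ iYE (measurable_wrtB sG mY mE).
split=> [YZ A GA|YXZ].
  have {}Zae := Zae.1 (filterS (fun w => @esym _ _ _) YZ) A GA.
  by rewrite Zae intYE// addrC subrK.
suff: {ae P, forall w, cond_exp P G Z w = (Y \- cond_exp P G X) w}.
  exact: filterS (fun w => @esym _ _ _).
by apply/Zae => A GA; rewrite intYE// YXZ// addrC addKr.
Qed.

End compensator.

(** * Adapted processes and one-step martingale criteria *)

Section processes.
Context (R : realType) (d : measure_display) (T : measurableType d).
Variables (F : nat -> set (set T)) (hF : filtration F).

Lemma filtration_sigma n : sigma_algebra setT (F n).
Proof. by case: hF. Qed.

Lemma filtration_sub n : F n `<=` measurable.
Proof. by case: hF. Qed.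

Lemma adapted_measurable (h : nat -> T -> R) n :
  adapted F h -> measurable_fun setT (h n).
Proof. by move=> /(_ n); exact/measurable_wrt_measurable_fun/filtration_sub. Qed.

Lemma integrable_expectation_abs (P : probability T R) (X : T -> R) :
  measurable_fun setT X -> ('E_P[fun w => `|X w|%R] < +oo)%E ->
  P.-integrable setT (EFin \o X).
Proof.
move=> mX; rewrite unlock => XP; apply/integrableP; split => //.
exact/measurable_EFinP.
Qed.

(* At time 0 integrability is not assumed: it holds because an
   [F 0]-measurable function is constant. *)
Lemma adapted_integrable (P : probability T R) (h : nat -> T -> R) :
  adapted F h ->
  (forall m, (1 <= m)%N -> ('E_P[fun w => `|h m w|%R] < +oo)%E) ->
  forall m, P.-integrable setT (EFin \o h m).
Proof.
move=> ah ih [|m]; last first.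
  by apply: integrable_expectation_abs (ih _ _) => //; exact: adapted_measurable.
have := ah 0%N; have [_ _ _ -> _] := hF => /measurable_wrt_trivial ->.
exact: finite_measure_integrable_cst.
Qed.

(** One-step identities chain by induction on [m], because a set of [F k] stays in every later
    [F m]. *)
Lemma martingale_stepP (P : probability T R) (h : nat -> T -> R) :
  adapted F h -> (forall m, P.-integrable setT (EFin \o h m)) ->
  (forall k m, (k <= m)%N ->
    {ae P, forall w, cond_exp P (F k) (h m) w = h k w}) <->
  forall m A, F m A -> \int[P]_(w in A) h m.+1 w = \int[P]_(w in A) h m w.
Proof.
move=> ah ih.
have aeP k m := cond_exp_aeP (@filtration_sigma k) (@filtration_sub k)
  (ih m) (ih k) (ah k).
split=> [hm m A FA|hm k m km]; first exact: ((aeP m m.+1).1 (hm _ _ _)).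
apply/aeP => A FA; elim: m km => [|m IHm]; first by rewrite leqn0 => /eqP ->.
rewrite leq_eqVlt => /predU1P[->//|km]; rewrite hm ?IHm//.
by case: hF => _ Fmono _ _ _; exact: Fmono FA.
Qed.

End processes.

(** * Uniform bounds on absolute moments *)

Section sup_integrable.
Context (R : realType) (d : measure_display) (T : measurableType d).
Variable M : set (probability T R).

Lemma sup_integrableP (h : nat -> T -> R) :
  sup_integrable M h <-> forall m, (1 <= m)%N ->
    exists c : R, forall P, M P -> ('E_P[fun w => `|h m w|%R] <= c%:E)%E.
Proof.
split=> hs m m1; last first.
  have [c hc] := hs m m1; apply: (@le_lt_trans _ _ c%:E); last exact: ltry.
  by apply: ge_ereal_sup => _ [P MP <-]; exact: hc.
have := hs m m1; set s := ereal_sup _ => s_lty.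
have hle P : M P -> ('E_P[fun w => `|h m w|%R] <= s)%E.
  by move=> MP; apply: ereal_sup_ubound; exists P.
case: s s_lty hle => [c _ hc|//|_ hc]; first by exists c.
(* A supremum of [-oo] covers the case of empty [M]; any real bound then works. *)
by exists 0 => P /hc /le_trans; apply; rewrite leNye.
Qed.

Lemma sup_integrable_lty (h : nat -> T -> R) P m : sup_integrable M h ->
  M P -> (1 <= m)%N -> ('E_P[fun w => `|h m w|%R] < +oo)%E.
Proof.
move=> /sup_integrableP hs MP /hs[c hc].
by apply: le_lt_trans (hc P MP) _; exact: ltry.
Qed.

End sup_integrable.

Section abs_expectation.
Context (R : realType) (d : measure_display) (T : measurableType d).
Variable P : probability T R.

Lemma le_expectation_abs (X Y : T -> R) :
  measurable_fun setT X -> measurable_fun setT Y ->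
  (forall w, `|X w| <= `|Y w|) ->
  ('E_P[fun w => `|X w|%R] <= 'E_P[fun w => `|Y w|%R])%E.
Proof.
move=> mX mY XY; apply: expectation_le => //.
- exact: measurableT_comp.
- exact: measurableT_comp.
- exact: aeW.
Qed.

Lemma expectation_absD_le (X Y : T -> R) :
  measurable_fun setT X -> measurable_fun setT Y ->
  ('E_P[fun w => `|(X \+ Y) w|%R] <=
   'E_P[fun w => `|X w|%R] + 'E_P[fun w => `|Y w|%R])%E.
Proof.
move=> mX mY; rewrite unlock -ge0_integralD//.
- apply: ge0_le_integral => //.
  + apply/measurable_EFinP; apply: measurableT_comp => //.
    exact: measurable_funD.
  + by apply: emeasurable_funD; apply/measurable_EFinP; exact: measurableT_comp.
  + by move=> w _; rewrite -EFinD lee_fin ler_normD.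
- by apply/measurable_EFinP; exact: measurableT_comp.
- by apply/measurable_EFinP; exact: measurableT_comp.
Qed.

End abs_expectation.

Theorem theorem1 (R : realType) (d : measure_display) (T : measurableType d)
    (F : nat -> set (set T)) (hF : filtration F)
    (M : set (probability T R))
    (hMconv : convex_measures M) (hMequiv : equivalent_measures M)
    (f : nat -> T -> R) (hf : supermartingale F M f)
    (hsup : sup_integrable M f) :
  local_regular F M f <->
  exists g : nat -> T -> R,
    [/\ adapted F g,
        forall m w, 0 <= g m w,
        sup_integrable M g
      & forall m P, (1 <= m)%N -> M P ->
          {ae P, forall w,
            f m.-1 w - cond_exp P (F m.-1) (f m) w
            = cond_exp P (F m.-1) (g m) w}].
Proof.
have sF := filtration_sigma hF; have FT := filtration_sub hF.
have af : adapted F f by case: hf.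
have integrable_of h P : adapted F h -> sup_integrable M h -> M P ->
    forall m, P.-integrable setT (EFin \o h m).
  move=> ah sh MP; apply: (adapted_integrable hF) => // m m1.
  exact: sup_integrable_lty sh MP m1.
have meas (h : nat -> T -> R) m : adapted F h -> measurable_fun setT (h m).
  exact: adapted_measurable.
have RintD (P : probability T R) X Y A : measurable A ->
    P.-integrable setT (EFin \o X) -> P.-integrable setT (EFin \o Y) ->
    \int[P]_(w in A) (X w + Y w) =
    \int[P]_(w in A) X w + \int[P]_(w in A) Y w.
  move=> mA iX iY; apply: RintegralD => //.
    exact: integrableS iX.
  exact: integrableS iY.
split=> [[_ _ [g [ag g0 gmono g00 [sg mg]]]]|[g [ag g0 sg fg]]].
(* The increments of [g] compensate [f]; at index 0 the predecessor is 0 again, so [h 0]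
   vanishes. *)
- pose h m := g m \- g m.-1.
  have h_ge0 m w : 0 <= h m w by rewrite subr_ge0 gmono// leq_pred.
  have ah : adapted F h.
    move=> m; apply: measurable_wrtB => //.
    have [_ Fmono _ _ _] := hF.
    by move=> B mB; apply: (Fmono m.-1 m) => //; [exact: leq_pred|exact: ag].
  have sh : sup_integrable M h.
    apply/sup_integrableP => m m1; have [c gc] := (sup_integrableP M g).1 sg m m1.
    (* As [g] is nonnegative and nondecreasing, [h m] lies between 0 and [g m], so the bound for [g]
       serves for [h]. *)
    exists c => P MP; apply: le_trans (gc P MP).
    apply: le_expectation_abs => [||w]; [exact: meas..|].
    by rewrite !ger0_norm// gerBl.
  exists h; split => // -[//|m] P _ MP /=.
  have iF := integrable_of _ _ af hsup MP.
  have ig := integrable_of _ _ ag sg MP.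
  have ih := integrable_of _ _ ah sh MP.
  apply/compensator_aeP => // A FA; have mA := FT _ _ FA.
  have [afg ifg Hfg] := mg P MP.
  have ifg' := adapted_integrable hF afg ifg.
  have := (martingale_stepP hF afg ifg').1 Hfg m A FA.
  rewrite (RintD _ _ _ _ mA (iF m.+1) (ig m.+1)) (RintD _ _ _ _ mA (iF m) (ig m)).
  move=> fgA.
  have -> : \int[P]_(w in A) h m.+1 w =
      \int[P]_(w in A) g m.+1 w - \int[P]_(w in A) g m w.
    rewrite RintegralB//; first exact: integrableS (ig _).
    exact: integrableS (ig _).
  by rewrite addrA fgA addrK.
(* The sum starts at [g 1]: the hypothesis does not constrain [g 0], and [h 0] has to be 0. *)
- pose h m w := \sum_(i < m) g i.+1 w.
  have hS m : h m.+1 = h m \+ g m.+1.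
    by apply/funext => w; rewrite /h big_ord_recr.
  have h0 : h 0%N = cst 0 by apply/funext => w; rewrite /h big_ord0.
  have ah : adapted F h.
    elim=> [|m IHm]; first by rewrite h0; exact: measurable_wrt_cst.
    have [_ Fmono _ _ _] := hF.
    rewrite hS; apply: measurable_wrtD => //.
    by move=> B mB; apply: (Fmono m) => //; exact: IHm.
  have sh : sup_integrable M h.
    (* The bound is proved from index 0 on so that induction can start; each step adds a bound for
       the new summand. *)
    apply/sup_integrableP => m _; elim: m => [|m [c hc]].
      exists 0 => P MP; rewrite (_ : (fun w => _) = cst 0) ?expectation_cst//.
      by apply/funext => w; rewrite h0 normr0.
    have [//|b gb] := (sup_integrableP M g).1 sg m.+1.
    exists (c + b) => P MP; rewrite hS EFinD.
    apply: le_trans (expectation_absD_le _ _ _) _; [exact: meas..|].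
    by apply: leeD; [exact: hc|exact: gb].
  split => //; exists h; split => //.
  + by move=> m w; exact: sumr_ge0.
  + move=> m n w /subnK <-; elim: (n - m)%N => // k /le_trans; apply.
    by rewrite addSn hS lerDl.
  + by move=> w; rewrite h0.
  split=> // P MP.
  have iF := integrable_of _ _ af hsup MP.
  have ig := integrable_of _ _ ag sg MP.
  have ih := integrable_of _ _ ah sh MP.
  have afh : adapted F (fun m w => f m w + h m w).
    by move=> m; apply: measurable_wrtD.
  have ifh m : P.-integrable setT (EFin \o (fun w => f m w + h m w)).
    exact: (integrableD measurableT (iF m) (ih m)).
  split => // [m m1|].
    apply: le_lt_trans (expectation_absD_le _ _ _) _; [exact: meas..|].
    by apply: lte_add_pinfty; apply: sup_integrable_lty MP m1.
  (* From [m] to [m.+1] the process [h] grows by [g m.+1], whose integral over [A] is exactly what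
     [f] loses. *)
  apply/(martingale_stepP hF) => // m A FA; have mA := FT _ _ FA.
  have := (compensator_aeP (sF m) (FT m) (iF m.+1) (iF m) (ig m.+1) (af m)).1
    (fg m.+1 P isT MP) A FA.
  have := RintD _ _ _ _ mA (ih m) (ig m.+1).
  rewrite (RintD _ _ _ _ mA (iF m.+1) (ih m.+1)) (RintD _ _ _ _ mA (iF m) (ih m)).
  by rewrite hS => -> ->; rewrite addrA addrAC.
Qed.
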